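(* Let $G$ be a finite group and let $R$ be an integral domain whose field of fractions has characteristic $0$. Assume that for every subgroup $U\le G$ and every prime divisor $p$ of $|\mathrm{Out}(U)|$ one has $pR\neq R$. Then $RB^{\lhd}(G,G)$ has no central idempotent different from $0$ and $1$. In particular, $0$ and $1$ are the only central idempotents of $B^{\lhd}(G,G)$.
   Context: A finite $(G,G)$-biset is a finite set with commuting left and right $G$-actions, identified with a left $G\times G$-set via $(g,h)x=gxh^{-1}$. $B(G,G)$ is the Grothendieck group of finite $(G,G)$-bisets w.r.t. disjoint union, a ring with multiplication induced by $X\times_G Y$ (the $G$-orbits of $X\times Y$ under $g(x,y)=(xg^{-1},gy)$). For $L\le G\times G$ let $k_1(L)=\{g\in G\mid (g,1)\in L\}$. The left-free double Burnside ring $B^{\lhd}(G,G)$ is the subring spanned by the classes of bisets all of whose point stabilizers $L$ satisfy $k_1(L)=1$, and $RB^{\lhd}(G,G)=R\otimes_{\mathbb{Z}}B^{\lhd}(G,G)$. *)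

(* Defs.v *)
From HB Require Import structures.
From mathcomp Require Import all_boot all_order all_algebra all_fingroup all_solvable.
From mathcomp Require Import fraction.

Set Implicit Arguments.
Unset Strict Implicit.
Unset Printing Implicit Defensive.

Import GroupScope.

(* Concrete model of the (left-free) double Burnside ring B^<|(G,G) with
   coefficients in a ring R.  A (G,G)-biset is a left (G x G)-set via
   (g,h)x = g x h^-1; the transitive biset attached to L <= G x G is the
   set of left cosets (G x G)/L.  R (x) B^<|(G,G) is the free R-module on
   the isomorphism classes of transitive bisets (G x G)/L with k1(L) = 1,
   i.e. on conjugacy classes of such L; we index a class by a canonical
   representative subgroup and represent an element by its coefficient
   function (zero outside the left-free representatives). *)

Section DoubleBurnside.

Variables (gT : finGroupType) (G : {group gT}).

Local Notation pT := (gT * gT)%type.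

Definition GxG : {set pT} := setX G G.

Definition k1 (L : {set pT}) : {set gT} := [set g | (g, 1) \in L].

Definition canon (L : {set pT}) : {set pT} := odflt L [pick K in L :^: GxG].

Definition is_rep (L : {set pT}) : bool :=
  [&& group_set L, L \subset GxG & canon L == L].

Definition is_lf_rep (L : {set pT}) : bool := is_rep L && (k1 L == 1).

Definition tbiset (L : {set pT}) : {set {set pT}} := lcosets L GxG.

(* the G-orbit of (x,y) in X x Y under g(x,y) = (x g^-1, g y);
   for X a left (G x G)-set: x g^-1 = (1,g) x and g y = (g,1) y *)
Definition torb (C D : {set pT}) : {set ({set pT} * {set pT})} :=
  [set (lcoset C (1, g), lcoset D (g, 1)) | g in G].

Definition tprod (L M : {set pT}) : {set {set ({set pT} * {set pT})}} :=
  [set torb C D | C in tbiset L, D in tbiset M].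

(* (a,b) [x,y] = a [x,y] b^-1 = [(a,1) x, (1,b) y] *)
Definition bact (u : pT) (O : {set ({set pT} * {set pT})})
  : {set ({set pT} * {set pT})} :=
  [set (lcoset p.1 (u.1, 1), lcoset p.2 (1, u.2)) | p in O].

Definition bstab (O : {set ({set pT} * {set pT})}) : {set pT} :=
  [set u in GxG | bact u O == O].
Definition borbit (O : {set ({set pT} * {set pT})}) :=
  [set bact u O | u in GxG].

(* multiplicity of the transitive biset (G x G)/N in X_L x_G X_M:
   number of (G x G)-orbits whose point stabilizers are conjugate to N *)
Definition bmult (L M N : {set pT}) : nat :=
  #|[set Om in [set borbit O | O in tprod L M]
       | [exists O in Om, bstab O \in N :^: GxG]]|.

Variable R : pzRingType.

Definition in_RBlf (c : {ffun {set pT} -> R}) : Prop :=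
  forall L, ~~ is_lf_rep L -> c L = 0%R.

Definition bmul (c d : {ffun {set pT} -> R}) : {ffun {set pT} -> R} :=
  [ffun N => if is_rep N then
      (\sum_(L : {set pT}) \sum_(M : {set pT}) (c L * d M) *+ bmult L M N)%R
    else 0%R].

Definition diagG : {set pT} := [set (g, g) | g in G].

Definition bone : {ffun {set pT} -> R} :=
  [ffun L => ((L == canon diagG)%:R)%R].

Definition bzero : {ffun {set pT} -> R} := [ffun _ => 0%R].

End DoubleBurnside.

Definition Inn (gT : finGroupType) (U : {group gT}) := conj_aut U @* U.
Definition Out_order (gT : finGroupType) (U : {group gT}) : nat :=
  #|Aut U : Inn U|.

(* Main.v *)
(** Write marks of a biset [X] as a matrix: for homomorphisms [f, h] from a
    finite group [U] to [G], let [n_X(f, h)] be the number of points of [X] fixed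
    by [{(f u, h u)}].  As bisets are left-free, [n_{XY} = n_X n_Y / |G|], so a
    central idempotent [e] acts on each [Hom(U, G)] by an idempotent matrix
    [n_e / |G|]; moreover [e] commutes with every class indicator of left-free
    subgroups, these being rational combinations of bisets.

    Fix an inclusion [i : U -> G] and let [I] be the set of injective homomorphisms
    whose image is conjugate to that of [i].  Commuting with the class of the
    diagonal of [U] shows that [n_e] is block diagonal with respect to [I]; its
    block [F] is an idempotent below the projector [D] onto [G]-invariants, of rank
    [N = |Aut U : Aut_G U|].  The trace of [F] is [N x], where [x] is in [R] because
    [C_G(U)] acts freely on the fixed points.  The trace of an idempotent is its
    rank [r <= N], and if [r / N] were not [0] or [1] some prime divisor of [N],
    hence of [|Out U|], would be invertible in [R].  So [F] is [0] or [D].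
    Commuting with the class of [1 x U] shows that every column sum of [F] is the
    value of [n_e / |G|] at the trivial homomorphisms, which does not depend on [U];
    hence the same alternative holds for all [U], and [e] has the marks of [0] or
    of [1]. *)

Require Import Defs.
From HB Require Import structures.
From mathcomp Require Import all_boot all_order all_algebra all_fingroup all_solvable.
From mathcomp Require Import fraction.

Set Implicit Arguments.
Unset Strict Implicit.
Unset Printing Implicit Defensive.

Import GroupScope GRing.Theory.

(** * Traces of idempotents over a domain of characteristic 0 *)

Section IdempotentTrace.
Local Open Scope ring_scope.

(** Factor [A = C B] through its rank. Idempotency and cancellation of both bases give [B C = 1], so
    cyclicity of the trace counts the rank. *)
Lemma mxtrace_idempotent (F : fieldType) (n : nat) (A : 'M[F]_n) :
  A *m A = A -> \tr A = (\rank A)%:R.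
Proof.
move=> AA; pose C := col_base A; pose B := row_base A.
have CB : C *m B = A := mulmx_base A.
have BC : B *m C = 1%:M.
  apply: (row_full_inj (col_base_full A)); apply: (row_free_inj (row_base_free A)).
  rewrite mulmx1 -/C -/B; change (C *m (B *m C) *m B = C *m B).
  by rewrite mulmxA CB -mulmxA CB AA.
by rewrite -[in LHS]CB mxtrace_mulC BC mxtrace1.
Qed.

Lemma char0_natr_eq0 (R : idomainType) :
  [pchar {fraction R}] =i pred0 -> forall n : nat, (n%:R == 0 :> R) = (n == 0%N).
Proof.
move=> char0 n.
rewrite -((pcharf0P _).1 char0 n) -tofrac_eq0.
by rewrite (rmorph_nat (@FracField.tofrac R)).
Qed.

Lemma char0_natr_inj (R : idomainType) :
  [pchar {fraction R}] =i pred0 -> injective (fun n : nat => n%:R : R).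
Proof.
move=> char0; suff le_inj m n : (m <= n)%N -> m%:R = n%:R :> R -> m = n.
  by move=> m n E; case/orP: (leq_total m n) => le; [|apply/esym]; apply: le_inj.
move=> le /esym/eqP; rewrite -subr_eq0 -natrB // char0_natr_eq0 // subn_eq0 => ge.
by apply/eqP; rewrite eqn_leq le.
Qed.

Lemma char0_mulrn_inj (R : idomainType) (m : nat) :
  [pchar {fraction R}] =i pred0 -> (0 < m)%N -> injective (fun x : R => x *+ m).
Proof.
move=> char0 m_gt0 x y /eqP; rewrite -subr_eq0 -mulrnBl -mulr_natr mulf_eq0.
by rewrite char0_natr_eq0 // eqn0Ngt m_gt0 orbF subr_eq0 => /eqP.
Qed.

(** Over the fraction field [a / m] is an idempotent matrix, and [r] is its rank. Keeping the factor
    [m] lets the statement stay inside [R]. *)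
Lemma sum_diag_quasi_idempotent (R : idomainType) (I : finType)
    (a : I -> I -> R) (m : nat) :
    [pchar {fraction R}] =i pred0 -> (0 < m)%N ->
    (forall i j, \sum_k a i k * a k j = a i j *+ m) ->
  exists2 r : nat, \sum_i a i i = (m * r)%:R & r = 0%N -> forall i j, a i j = 0.
Proof.
move=> char0 m_gt0 aa.
have m_neq0 : m%:R != 0 :> {fraction R} by rewrite ((pcharf0P _).1 char0) -lt0n.
pose A : 'M[{fraction R}]_#|I| :=
  \matrix_(i, j) (m%:R^-1 * tofrac (a (enum_val i) (enum_val j))).
have sum_enum (g : I -> R) : \sum_(i < #|I|) tofrac (g (enum_val i)) = tofrac (\sum_i g i).
  by rewrite -(big_enum_val (A := I) (fun i => tofrac (g i))) /= (raddf_sum (@FracField.tofrac R)).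
have AA : A *m A = A.
  apply/matrixP => i j; rewrite !mxE.
  under eq_bigr => k _ do rewrite !mxE mulrACA -tofracM.
  rewrite -mulr_sumr (sum_enum (fun k => a (enum_val i) k * a k (enum_val j))).
  by rewrite aa tofracMn -[tofrac _ *+ m]mulr_natl -mulrA mulKf.
exists (\rank A).
  have trA : \tr A = m%:R^-1 * tofrac (\sum_i a i i).
    rewrite /mxtrace -(sum_enum (fun k => a k k)) mulr_sumr.
    by apply: eq_bigr => k _; rewrite mxE.
  apply/eqP; rewrite -tofrac_eq natrM tofracM !(rmorph_nat (@FracField.tofrac R)).
  by rewrite -(mxtrace_idempotent AA) trA mulVKf.
move/eqP; rewrite mxrank_eq0 => /eqP A0 i j.
have /eqP := congr1 (fun B : 'M__ => B (enum_rank i) (enum_rank j)) A0.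
rewrite !mxE !enum_rankK mulf_eq0 invr_eq0 (negPf m_neq0) /=.
by rewrite tofrac_eq0 => /eqP.
Qed.

(** Cancelling the gcd writes [x] as a reduced fraction [s / k]. Its presence in [R] makes [k] a
    unit, and so would be every prime divisor of [k], all of which divide [n]; hence [k = 1]. *)
Lemma mulrn_eq_natr_cases (R : idomainType) (x : R) (n r : nat) :
    [pchar {fraction R}] =i pred0 -> (0 < n)%N -> (r <= n)%N ->
    (forall p : nat, prime p -> (p %| n)%N -> p%:R \isn't a @GRing.unit R) ->
  x *+ n = r%:R -> r = 0%N \/ r = n.
Proof.
move=> char0 n_gt0 rn nonunit xn.
have [r0|r_gt0] := posnP r; [by left | right].
have d_gt0 : (0 < gcdn n r)%N by rewrite gcdn_gt0 n_gt0.
have [k Dn] := dvdnP (dvdn_gcdl n r); have [s Dr] := dvdnP (dvdn_gcdr n r).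
set d := gcdn n r in d_gt0 Dn Dr.
have xk : x *+ k = s%:R.
  apply: (char0_mulrn_inj char0 d_gt0); rewrite -mulrnA -mulrnA.
  by rewrite -Dn -Dr xn.
have k_gt0 : (0 < k)%N by move: n_gt0; rewrite Dn muln_gt0 => /andP[].
have cop : gcdn k s = 1%N.
  apply/eqP; rewrite -(eqn_pmul2r d_gt0) mul1n muln_gcdl -Dn -Dr; exact/eqP.
have k_unit : k%:R \is a @GRing.unit R.
  have [a _ /dvdnP[b Dab]] := Bezoutl s k_gt0; rewrite cop in Dab.
  (* Bezout gives [1 + a s = b k]; substituting [s = x k] yields [k (b - a x) = 1]. *)
  apply/unitrPr; exists (b%:R - a%:R * x).
  rewrite mulrBr -!natrM mulnC -Dab mulrCA [_ * x]mulr_natl xk -natrM.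
  by rewrite natrD addrK.
have [k1|k_gt1] := leqP k 1; last first.
  have pn : (pdiv k %| n)%N by rewrite Dn dvdn_mulr // pdiv_dvd.
  have [q Dk] := dvdnP (pdiv_dvd k); move: k_unit.
  by rewrite Dk natrM unitrM (negPf (nonunit _ (pdiv_prime k_gt1) pn)) andbF.
have Dk : k = 1%N by apply/eqP; rewrite eqn_leq k1.
apply/eqP; rewrite eqn_leq rn Dn Dk mul1n.
exact: dvdn_leq r_gt0 (dvdn_gcdr n r).
Qed.
End IdempotentTrace.

(** Plays the part of the orbit-stabiliser theorem in the counts below, where the fibres are cosets
    or orbits; [P] restricts the count to fixed points. *)
Lemma card_fibers (aT rT : finType) (f : aT -> rT) (S : {set aT}) (P : pred rT)
    (k : nat) :
    (forall y, y \in f @: S -> #|[set x in S | f x == y]| = k) ->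
  #|[set x in S | P (f x)]| = (k * #|[set y in f @: S | P y]|)%N.
Proof.
move=> fib.
rewrite -sum1_card (partition_big f (mem [set y in f @: S | P y])) /=; last first.
  by move=> x; rewrite !inE => /andP[xS ->]; rewrite imset_f.
rewrite mulnC -sum_nat_const; apply: eq_bigr => y; rewrite inE => /andP[yS Py].
rewrite -(fib y yS) -sum1_card; apply: eq_bigl => x; rewrite !inE.
by case: eqP => [->|]; rewrite ?Py ?andbT ?andbF.
Qed.

(** * Marks of transitive bisets and fixed points of their products *)

Section Marks.
Variables (gT : finGroupType) (G : {group gT}).
Local Notation pT := (gT * gT)%type.
Local Notation GG := (GxG G).

Canonical GxG_group := Group (valP (setX_group G G) : group_set GG).

(* [inE] would unfold [GxG G] and split membership into components. *)
Lemma in_sep (T : finType) (A : {set T}) (P : pred T) (x : T) :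
  (x \in [set y in A | P y]) = (x \in A) && P x.
Proof. by rewrite inE. Qed.

Definition fixes (A C : {set pT}) := [forall a in A, lcoset C a == C].

Definition mark (L A : {set pT}) : nat := #|[set C in tbiset G L | fixes A C]|.

Lemma mem_GxG (a b : gT) : ((a, b) \in GG) = (a \in G) && (b \in G).
Proof. exact: in_setX. Qed.

Lemma lcoset_fix (L : {group pT}) (a v : pT) :
  (lcoset (lcoset L v) a == lcoset L v) = (a ^ v \in L).
Proof.
by rewrite !lcosetE -lcosetM (sameP eqP lcoset_eqP) mem_lcoset mulgA conjgE mulgA.
Qed.

Lemma fixes_lcoset (L : {group pT}) (A : {set pT}) (v : pT) :
  fixes A (lcoset L v) = (A :^ v \subset L).
Proof.
apply/forall_inP/subsetP => [fixA _ /imsetP[a aA ->] | AL a aA].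
  by rewrite -lcoset_fix fixA.
by rewrite lcoset_fix AL // memJ_conjg.
Qed.

(** Each coset of [L] has [#|L|] representatives [v], and it is fixed by [A] exactly when they
    satisfy [A :^ v \subset L]. Counting elements instead of cosets turns conjugation invariance of
    marks into translation of a set. *)
Lemma mark_card (L : {group pT}) (A : {set pT}) : L \subset GG ->
  (#|L| * mark L A)%N = #|[set v in GG | A :^ v \subset L]|.
Proof.
move=> LG; rewrite -(card_fibers (f := lcoset L) (fixes A)).
  by apply: eq_card => v; rewrite !in_sep fixes_lcoset.
move=> _ /imsetP[w wG ->]; rewrite -(card_lcoset L w); apply: eq_card => v.
rewrite in_sep !lcosetE (sameP eqP lcoset_eqP); apply: andb_idl.
by case/lcosetP=> l lL ->; rewrite groupM // (subsetP LG).
Qed.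

Lemma mark_conjl (L : {group pT}) (A : {set pT}) (v : pT) :
  L \subset GG -> v \in GG -> mark (L :^ v) A = mark L A.
Proof.
move=> LG vG; have LvG : L :^ v \subset GG by rewrite -(conjGid vG) conjSg.
apply/eqP; rewrite -(eqn_pmul2l (cardG_gt0 L)) mark_card //.
rewrite -{1}(cardJg L v) !mark_card // -[X in _ == X](card_rcoset _ v); apply/eqP/eq_card => w.
by rewrite mem_rcoset !in_sep groupMr ?groupV // conjsgM sub_conjgV.
Qed.

Lemma mark_conjr (L : {group pT}) (A : {set pT}) (v : pT) :
  L \subset GG -> v \in GG -> mark L (A :^ v) = mark L A.
Proof.
move=> LG vG; apply/eqP; rewrite -(eqn_pmul2l (cardG_gt0 L)) !mark_card //.
rewrite -[X in _ == X](card_lcoset _ v^-1); apply/eqP/eq_card => w.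
by rewrite mem_lcoset invgK !in_sep groupMl // conjsgM.
Qed.

Lemma mark_neq0 (L : {group pT}) (A : {set pT}) : L \subset GG ->
  mark L A != 0 -> exists2 v, v \in GG & A :^ v \subset L.
Proof.
move=> LG m0; have: #|[set v in GG | A :^ v \subset L]| != 0.
  by rewrite -mark_card // muln_eq0 negb_or -lt0n cardG_gt0.
by rewrite cards_eq0 => /set0Pn[v]; rewrite in_sep => /andP[vG Av]; exists v.
Qed.

Lemma mark_refl_gt0 (L : {group pT}) : L \subset GG -> 0 < mark L L.
Proof.
move=> LG; rewrite lt0n -(eqn_pmul2l (cardG_gt0 L)) muln0 mark_card // cards_eq0.
by apply/set0Pn; exists 1; rewrite in_sep group1 conjsg1 subxx.
Qed.

Lemma canon_conj (L : {set pT}) : canon G L \in L :^: GG.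
Proof.
rewrite /canon; case: pickP => [K //|/(_ L)] /=.
by rewrite (_ : L \in _) //; apply/imsetP; exists 1; rewrite ?group1 ?conjsg1.
Qed.

Lemma canonP (L : {set pT}) : exists2 v, v \in GG & canon G L = L :^ v.
Proof. exact/imsetP/canon_conj. Qed.

Lemma eq_canon (L : {set pT}) (v : pT) : v \in GG -> canon G (L :^ v) = canon G L.
Proof.
move=> vG; rewrite /canon.
have E : (L :^ v) :^: GG =i L :^: GG.
  move=> K; apply/imsetP/imsetP => [[w wG ->]|[w wG ->]].
    by exists (v * w); rewrite ?groupM ?conjsgM.
  by exists (v^-1 * w); rewrite ?groupM ?groupV -?conjsgM ?mulKVg.
rewrite (eq_pick E); case: pickP => [//|/(_ L)] /=.
by rewrite (_ : L \in _) //; apply/imsetP; exists 1; rewrite ?group1 ?conjsg1.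
Qed.

Lemma canon_rep (L : {group pT}) : L \subset GG -> is_rep G (canon G L).
Proof.
move=> LG; have [v vG E] := canonP L; rewrite /is_rep E eq_canon // E eqxx andbT.
by rewrite -(conjGid vG) conjSg LG andbT groupP.
Qed.

Lemma is_repP (L : {set pT}) : is_rep G L ->
  exists2 K : {group pT}, L = K & L \subset GG /\ canon G L = L.
Proof. by case/and3P=> gL LG /eqP cL; exists (Group gL). Qed.

Lemma k1_conj (L : {set pT}) (v : pT) : k1 L = 1 -> k1 (L :^ v) = 1.
Proof.
case: v => a b kL; apply/setP => g.
have -> : (g \in k1 (L :^ (a, b))) = (g ^ a^-1 \in k1 L).
  by rewrite !inE mem_conjg -[in RHS](conj1g b^-1).
by rewrite kL !inE -{1}(conj1g a^-1) (inj_eq (conjg_inj _)).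
Qed.

Lemma bactM (u v : pT) O : bact (u * v) O = bact u (bact v O).
Proof.
rewrite /bact -imset_comp; apply: eq_imset => -[C D] /=.
by rewrite !lcosetE -!lcosetM; congr (_ *: _, _ *: _); congr (_, _); rewrite mulg1.
Qed.

Lemma bact1 O : bact (1 : pT) O = O.
Proof.
rewrite -[RHS]imset_id; apply: eq_imset => -[C D] /=.
by rewrite !lcosetE -[(1, 1)]/(1 : pT) !mul1g.
Qed.

Lemma bact_torb (u : pT) C D :
  bact u (torb G C D) = torb G (lcoset C (u.1, 1)) (lcoset D (1, u.2)).
Proof.
rewrite /bact -imset_comp; apply: eq_imset => g /=.
by rewrite !lcosetE -!lcosetM; congr (_ *: _, _ *: _); congr (_, _);
  rewrite ?mulg1 ?mul1g.
Qed.

Lemma lcoset_tbiset (L C : {set pT}) (u : pT) :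
  u \in GG -> C \in tbiset G L -> lcoset C u \in tbiset G L.
Proof.
move=> uG /imsetP[v vG ->]; apply/imsetP; exists (u * v); first exact: groupM.
by rewrite !lcosetE lcosetM.
Qed.

Lemma torb_self C D : (C, D) \in torb G C D.
Proof.
by apply/imsetP; exists 1; rewrite ?group1 //= !lcosetE !mul1g.
Qed.

Lemma torb_shift C D (g : gT) : g \in G ->
  torb G (lcoset C (1, g)) (lcoset D (g, 1)) = torb G C D.
Proof.
move=> gG; apply/setP => p; apply/imsetP/imsetP => -[h hG ->].
  exists (h * g); rewrite ?groupM // !lcosetE -!lcosetM.
  by congr (_ *: _, _ *: _); congr (_, _); rewrite mulg1.
exists (h * g^-1); rewrite ?groupM ?groupV // !lcosetE -!lcosetM.
by congr (_ *: _, _ *: _); congr (_, _); rewrite ?mulg1 ?mulgKV.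
Qed.

Lemma torb_eqE C D C' D' :
  (torb G C' D' == torb G C D) = ((C', D') \in torb G C D).
Proof.
apply/eqP/idP => [<-|/imsetP[g gG [-> ->]]]; [exact: torb_self | exact: torb_shift].
Qed.

(** For [(a, b)] representing the coset [D], conjugating [(h^-1 g, 1)] by [(a, b)] lands in [M],
    hence its first component lies in the trivial group [k1 M]. *)
Lemma lf_free (M : {group pT}) D (g h : gT) :
  k1 M = 1 -> D \in tbiset G M -> lcoset D (g, 1) = lcoset D (h, 1) -> g = h.
Proof.
move=> kM /imsetP[[a b] vG ->]; rewrite !lcosetE -!lcosetM => /lcoset_eqP.
rewrite mem_lcoset => inM.
have: (h^-1 * g) ^ a \in k1 M.
  rewrite inE (_ : (_, 1) = ((h, 1) * (a, b))^-1 * ((g, 1) * (a, b))) //.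
  by congr (_, _); rewrite /= ?mul1g ?mulVg // invMg conjgE !mulgA.
by rewrite kM !inE -{1}(conj1g a) (inj_eq (conjg_inj _)) -eq_mulVg1 => /eqP.
Qed.

Lemma tprodE (L M : {set pT}) :
  tprod G L M = (fun p => torb G p.1 p.2) @: setX (tbiset G L) (tbiset G M).
Proof.
apply/setP => O; apply/imset2P/imsetP => [[C D CL DM ->] | [[C D] /setXP[CL DM] ->]].
  by exists (C, D); rewrite ?in_setX ?CL.
by exists C D.
Qed.

Lemma torb_sub_tbiset (L M C D : {set pT}) p :
    C \in tbiset G L -> D \in tbiset G M -> p \in torb G C D ->
  p \in setX (tbiset G L) (tbiset G M).
Proof.
move=> CL DM /imsetP[g gG ->]; rewrite in_setX /=.
by rewrite !lcoset_tbiset // mem_GxG group1 gG.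
Qed.

Lemma tprod_bact (L M : {set pT}) O (u : pT) :
  u \in GG -> O \in tprod G L M -> bact u O \in tprod G L M.
Proof.
case: u => a b; rewrite mem_GxG => /andP[aG bG] /imset2P[C D CL DM ->].
by rewrite bact_torb; apply: imset2_f; rewrite lcoset_tbiset // mem_GxG group1 ?aG ?bG.
Qed.

Lemma card_torb (M : {group pT}) C D :
  k1 M = 1 -> D \in tbiset G M -> #|torb G C D| = #|G|.
Proof.
move=> kM DM; apply: card_in_imset => g h gG hG [_].
exact: (lf_free kM DM).
Qed.

Definition bfixes (A : {set pT}) O := [forall a in A, bact a O == O].

(** Left-freeness of [M] makes every point of the product an orbit of exactly [#|G|] pairs; this is
    the source of the factor [#|G|] in the product formula. *)
Lemma card_tprod_fix (L : {set pT}) (M : {group pT}) (A : {set pT}) :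
    k1 M = 1 ->
  (#|G| * #|[set O in tprod G L M | bfixes A O]|)%N
    = #|[set p in setX (tbiset G L) (tbiset G M) | bfixes A (torb G p.1 p.2)]|.
Proof.
move=> kM; rewrite tprodE.
rewrite -(card_fibers (f := fun p => torb G p.1 p.2) (bfixes A)) //.
move=> _ /imsetP[[C D] /setXP[CL DM] ->] /=; rewrite -(card_torb C kM DM).
apply: eq_card => -[C' D']; rewrite in_sep /= torb_eqE; apply: andb_idl.
exact: torb_sub_tbiset.
Qed.

Lemma bstab_group_set O : group_set (bstab G O).
Proof.
apply/group_setP; split=> [|u v]; first by rewrite in_sep group1 bact1 eqxx.
rewrite !in_sep => /andP[uG /eqP fu] /andP[vG /eqP fv].
by rewrite groupM // bactM fv fu eqxx.
Qed.
Canonical bstab_group O := Group (bstab_group_set O).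

Lemma bstab_sub O : bstab G O \subset GG.
Proof. by apply/subsetP => u; rewrite in_sep => /andP[]. Qed.

Lemma bact_eq O (u v : pT) : u \in GG -> v \in GG ->
  (bact u O == bact v O) = (v^-1 * u \in bstab G O).
Proof.
move=> uG vG; rewrite in_sep groupM ?groupV //= bactM.
apply/eqP/eqP => [-> | E]; first by rewrite -bactM mulVg bact1.
by rewrite -[in RHS]E -!bactM mulgV mul1g.
Qed.

Lemma bfixes_bact (A : {set pT}) O (v : pT) : A \subset GG -> v \in GG ->
  bfixes A (bact v O) = (A :^ v \subset bstab G O).
Proof.
move=> /subsetP AG vG.
have E a : a \in A -> (bact a (bact v O) == bact v O) = (a ^ v \in bstab G O).
  by move=> aA; rewrite -bactM bact_eq // groupM // AG.
apply/forall_inP/subsetP => [fixA _ /imsetP[a aA ->] | AS a aA].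
  by rewrite -E ?fixA.
by rewrite E ?AS // memJ_conjg.
Qed.

Lemma bstab_bact O (u : pT) : u \in GG -> bstab G (bact u O) = bstab G O :^ u^-1.
Proof.
move=> uG; apply/setP => v; rewrite mem_conjg invgK [LHS]in_sep.
have [vG | vG] := boolP (v \in GG); first by rewrite /= -bactM bact_eq // groupM.
apply/esym/negbTE; apply: contra vG => /(subsetP (bstab_sub O)).
by rewrite groupJr.
Qed.

(** An orbit is isomorphic to the cosets of a point stabiliser. Both counts are compared after
    multiplication by the order of that stabiliser. *)
Lemma card_borbit_fix (A : {set pT}) O : A \subset GG ->
  #|[set O' in borbit G O | bfixes A O']| = mark (bstab G O) A.
Proof.
move=> AG; apply/eqP; rewrite -(eqn_pmul2l (cardG_gt0 (bstab_group O))).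
rewrite mark_card ?bstab_sub //=.
rewrite -(card_fibers (f := fun v => bact v O) (bfixes A)).
  apply/eqP/eq_card => v; rewrite !in_sep; apply: andb_id2l => vG.
  by rewrite bfixes_bact.
move=> _ /imsetP[w wG ->]; rewrite -[RHS](card_lcoset _ w); apply: eq_card => v.
rewrite in_sep mem_lcoset; have [vG | vG] := boolP (v \in GG).
  by rewrite /= bact_eq.
apply/esym/negbTE; apply: contra vG => /(subsetP (bstab_sub O)).
by rewrite groupMl ?groupV.
Qed.

Lemma borbit_self O : O \in borbit G O.
Proof. by apply/imsetP; exists 1; rewrite ?group1 ?bact1. Qed.

Lemma borbit_eqE O O' : (borbit G O' == borbit G O) = (O' \in borbit G O).
Proof.
apply/eqP/idP => [<-|/imsetP[u uG ->]]; first exact: borbit_self.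
apply/setP => P; apply/imsetP/imsetP => -[v vG ->].
  by exists (v * u); rewrite ?groupM ?bactM.
by exists (v * u^-1); rewrite ?groupM ?groupV -?bactM ?mulgKV.
Qed.

(** Cut the product into [GG]-orbits: [bmult] counts each orbit for a single representative [N], the
    canonical conjugate of its stabilisers. *)
Lemma sum_bmult_mark (L M A : {set pT}) : A \subset GG ->
  (\sum_(N | is_rep G N) bmult G L M N * mark N A)%N
    = #|[set O in tprod G L M | bfixes A O]|.
Proof.
move=> AG; rewrite -[RHS]sum1_card.
rewrite (partition_big (borbit G) (mem (borbit G @: tprod G L M))) /=; last first.
  by move=> O; rewrite in_sep => /andP[OT _]; apply: imset_f.
under eq_bigr => N _.
  rewrite /bmult -sum1_card big_distrl /=.
  under eq_bigl => Om do rewrite in_sep.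
  rewrite big_mkcondr /=.
  over.
rewrite exchange_big /=; apply: eq_bigr => _ /imsetP[O OT ->].
rewrite -big_mkcondr (big_pred1 (canon G (bstab G O))) => [|N].
  have [v vG ->] := canonP (bstab G O).
  rewrite mul1n mark_conjl ?bstab_sub // -card_borbit_fix // -sum1_card.
  apply: eq_bigl => P; rewrite !in_sep borbit_eqE -andbA [bfixes _ _ && _]andbC.
  by apply: esym; apply: andb_idl => /andP[/imsetP[u uG ->] _]; apply: tprod_bact.
apply/andP/eqP => [[repN /exists_inP[_ /imsetP[u uG ->]]] | ->].
  rewrite bstab_bact // => /imsetP[w wG E].
  have [_ _ [_ <-]] := is_repP repN.
  by rewrite -(eq_canon _ wG) -E eq_canon ?groupV.
split; first exact: canon_rep (bstab_sub O).
apply/exists_inP; exists O; first exact: borbit_self.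
have [v vG ->] := canonP (bstab G O).
by apply/imsetP; exists v^-1; rewrite ?groupV ?conjsgK.
Qed.

End Marks.

(** * Marks at graphs of pairs of homomorphisms multiply like matrices *)

Section Ghost.
Variables (gT : finGroupType) (G : {group gT}).
Local Notation pT := (gT * gT)%type.
Local Notation GG := (GxG G).

Section Homs.
Variable uT : finGroupType.
Implicit Types (f h x : {ffun uT -> gT}) (C D : {set pT}).

(** Homomorphisms are total finite functions on a type, so that they form a finite set over which
    matrix products can be summed. *)
Definition homs : {set {ffun uT -> gT}} :=
  [set f : {ffun uT -> gT} |
    [forall u, f u \in G] && [forall u, forall v, f (u * v) == f u * f v]].

Definition graph (f h : {ffun uT -> gT}) : {set pT} := [set (f u, h u) | u : uT].

Lemma homsP (f : {ffun uT -> gT}) :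
  reflect ((forall u, f u \in G) /\ {morph f : u v / u * v}) (f \in homs).
Proof.
rewrite inE; apply: (iffP andP) => -[fG fM]; split; try exact/forallP.
  by move=> u v; apply/eqP; move/forallP/(_ u)/forallP: fM.
by apply/forallP => u; apply/forallP => v; rewrite fM.
Qed.

Lemma homs_in f u : f \in homs -> f u \in G.
Proof. by case/homsP=> fG _; apply: fG. Qed.

Lemma homsM f : f \in homs -> {morph f : u v / u * v}.
Proof. by case/homsP. Qed.

Lemma homs1 f : f \in homs -> f 1 = 1.
Proof. by move=> fH; apply: (mulgI (f 1)); rewrite -homsM // !mulg1. Qed.

Lemma graph_group_set f h : f \in homs -> h \in homs -> group_set (graph f h).
Proof.
move=> fH hH; apply/group_setP; split=> [|_ _ /imsetP[u _ ->] /imsetP[v _ ->]].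
  by apply/imsetP; exists 1; rewrite ?homs1.
by apply/imsetP; exists (u * v); rewrite ?homsM.
Qed.

Lemma graph_sub f h : f \in homs -> h \in homs -> graph f h \subset GG.
Proof.
move=> fH hH; apply/subsetP => _ /imsetP[u _ ->].
by rewrite mem_GxG !homs_in.
Qed.

Lemma fixes_graphP f h C :
  reflect (forall u, lcoset C (f u, h u) = C) (fixes (graph f h) C).
Proof.
apply: (iffP forall_inP) => [fixC u | fixC _ /imsetP[u _ ->]]; last by rewrite fixC.
by apply/eqP/fixC/imset_f.
Qed.

(** If [(a, b)] moves [(C, D)] within its [G]-orbit, the element of [G] undoing the move serves as
    middle component [g]. *)
Lemma bact_torb_fix (a b : gT) C D :
  (bact (a, b) (torb G C D) == torb G C D)
  = [exists g in G, (lcoset C (a, g) == C) && (lcoset D (g, b) == D)].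
Proof.
have E (X : {set pT}) (u v w : pT) : u * v = w -> lcoset (lcoset X v) u = lcoset X w.
  by move=> <-; rewrite !lcosetE lcosetM.
have E1 (X : {set pT}) : lcoset X (1, 1) = X by rewrite lcosetE mul1g.
rewrite bact_torb torb_eqE /=; apply/imsetP/exists_inP => -[g gG].
  move=> [EC ED]; exists g^-1; rewrite ?groupV //; apply/andP; split; apply/eqP.
    rewrite -(E C (1, g^-1) (a, 1)) ?EC; last by congr (_, _); rewrite ?mul1g ?mulg1.
    by rewrite (E _ _ _ (1, 1)) ?E1 //; congr (_, _); rewrite /= ?mul1g ?mulVg.
  rewrite -(E D (g^-1, 1) (1, b)) ?ED; last by congr (_, _); rewrite ?mul1g ?mulg1.
  by rewrite (E _ _ _ (1, 1)) ?E1 //; congr (_, _); rewrite /= ?mul1g ?mulVg.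
case/andP=> /eqP EC /eqP ED; exists g^-1; rewrite ?groupV //.
congr (_, _).
  by rewrite -{2}EC (E _ _ _ (a, 1)) //; congr (_, _); rewrite /= ?mul1g ?mulVg.
by rewrite -{2}ED (E _ _ _ (1, b)) //; congr (_, _); rewrite /= ?mul1g ?mulVg.
Qed.

(* Left-freeness of [M] makes the intermediate homomorphism [x] unique. *)
Lemma card_fixes_comp (L : {set pT}) (M : {group pT}) f h C D :
    k1 M = 1 -> f \in homs -> h \in homs ->
    C \in tbiset G L -> D \in tbiset G M ->
  #|[set x in homs | fixes (graph f x) C && fixes (graph x h) D]|
    = bfixes (graph f h) (torb G C D).
Proof.
move=> kM fH hH CL DM.
have uniq_mid (b g g' : gT) : b \in G ->
    lcoset D (g, b) = D -> lcoset D (g', b) = D -> g = g'.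
  move=> bG Eg Eg'; apply: (lf_free (G := G) (D := lcoset D (1, b)) kM).
    by rewrite lcoset_tbiset // mem_GxG group1.
  have EE (k : gT) : lcoset (lcoset D (1, b)) (k, 1) = lcoset D (k, b).
    rewrite !lcosetE -lcosetM; congr (_ *: _); congr (_, _).
      by rewrite mulg1.
    by rewrite mul1g.
  by rewrite !EE Eg.
have [/forall_inP fixT | notfix] := boolP (bfixes _ _); last first.
  apply/eqP; rewrite cards_eq0; apply: contraR notfix => /set0Pn[x].
  rewrite in_sep => /and3P[xH /fixes_graphP xC /fixes_graphP xD].
  apply/forall_inP => _ /imsetP[u _ ->]; rewrite bact_torb_fix.
  by apply/exists_inP; exists (x u); rewrite ?homs_in // xC xD !eqxx.
have: forall u, exists g,
    [&& g \in G, lcoset C (f u, g) == C & lcoset D (g, h u) == D].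
  move=> u; have := fixT (f u, h u) (imset_f _ isT); rewrite bact_torb_fix.
  by case/exists_inP=> g gG ED; exists g; rewrite gG.
case/fin_all_exists=> x0 x0P; pose x := [ffun u => x0 u].
have xG u : x u \in G by rewrite ffunE; case/and3P: (x0P u).
have xC u : lcoset C (f u, x u) = C by rewrite ffunE; case/and3P: (x0P u) => _ /eqP.
have xD u : lcoset D (x u, h u) = D by rewrite ffunE; case/and3P: (x0P u) => _ _ /eqP.
(* Both [x (u * v)] and [x u * x v] are middle components over [h (u * v)], so uniqueness makes the
   pointwise choice multiplicative. *)
have xH : x \in homs.
  apply/homsP; split=> // u v; apply: (uniq_mid (h (u * v))) => //.
    exact: homs_in.
  rewrite homsM // -[(_, _)]/((x u, h u) * (x v, h v)) lcosetE lcosetM -!lcosetE.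
  by rewrite !xD.
rewrite (_ : [set _ in _ | _] = [set x]) ?cards1 //; apply/setP => y.
rewrite in_sep in_set1; apply/and3P/eqP => [[yH _ /fixes_graphP yD] | ->].
  by apply/ffunP => u; apply: (uniq_mid (h u)) => //; apply: homs_in.
by split=> //; apply/fixes_graphP.
Qed.

(** A pair [(C, D)] whose orbit is fixed has exactly one middle homomorphism [x], so the fixed pairs
    can be sorted by [x]. *)
Lemma sum_mark_comp (L : {set pT}) (M : {group pT}) f h :
    k1 M = 1 -> f \in homs -> h \in homs ->
  (#|G| * \sum_(N | is_rep G N) bmult G L M N * mark G N (graph f h))%N
    = (\sum_(x in homs) mark G L (graph f x) * mark G M (graph x h))%N.
Proof.
move=> kM fH hH; rewrite sum_bmult_mark ?graph_sub // card_tprod_fix //.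
rewrite -sum1_card; under eq_bigl => p do rewrite in_sep.
rewrite big_mkcondr /=.
transitivity (\sum_(p in setX (tbiset G L) (tbiset G M)) \sum_(x in homs)
    (fixes (graph f x) p.1 && fixes (graph x h) p.2 : nat))%N.
  apply: eq_bigr => -[C D] /setXP[CL DM] /=.
  rewrite -[LHS]/(bfixes (graph f h) (torb G C D) : nat).
  rewrite -(card_fixes_comp (L := L) kM) // -sum1_card.
  under eq_bigl => x do rewrite in_sep.
  by rewrite big_mkcondr.
rewrite exchange_big /=; apply: eq_bigr => x _.
rewrite /mark -cardsX -sum1_card big_mkcond [RHS]big_mkcond /=.
apply: eq_bigr => -[C D] _; rewrite !in_setX /= !in_sep.
by case: (C \in _); case: (D \in _) => //=; case: (fixes _ C); case: (fixes _ D).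
Qed.

Section Coefficients.
Variable R : pzRingType.
Local Open Scope ring_scope.

Definition ghost (c : {ffun {set pT} -> R}) (A : {set pT}) : R :=
  \sum_L c L *+ mark G L A.

Lemma in_RBlfP (c : {ffun {set pT} -> R}) L : in_RBlf G c -> c L != 0 ->
  exists2 K : {group pT}, L = K & [/\ L \subset GG, canon G L = L & k1 L = 1%g].
Proof.
move=> cR cL; have: is_lf_rep G L by apply: contraR cL => /cR ->.
by case/andP=> /is_repP[K -> [KG cK]] /eqP kK; exists K.
Qed.

(** Bilinear extension of [sum_mark_comp], once the multiplicities [bmult] are regrouped under the
    marks. *)
Lemma ghost_bmul (c d : {ffun {set pT} -> R}) f h :
    in_RBlf G d -> f \in homs -> h \in homs ->
  ghost (bmul G c d) (graph f h) *+ #|G|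
    = \sum_(x in homs) ghost c (graph f x) * ghost d (graph x h).
Proof.
move=> dR fH hH; set A := graph f h.
have -> : ghost (bmul G c d) A
    = \sum_L \sum_M (c L * d M) *+ (\sum_(N | is_rep G N) bmult G L M N * mark G N A)%N.
  transitivity (\sum_(N | is_rep G N) \sum_L \sum_M
      (c L * d M) *+ (bmult G L M N * mark G N A)%N).
    rewrite /ghost [RHS]big_mkcond; apply: eq_bigr => N _; rewrite ffunE.
    case: ifP => _; last by rewrite mul0rn.
    rewrite -sumrMnl; apply: eq_bigr => L _.
    by rewrite -sumrMnl; apply: eq_bigr => M _; rewrite -mulrnA.
  rewrite exchange_big; apply: eq_bigr => L _.
  by rewrite exchange_big; apply: eq_bigr => M _; rewrite -sumrMnr.
transitivity (\sum_L \sum_M \sum_(x in homs)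
    (c L *+ mark G L (graph f x)) * (d M *+ mark G M (graph x h))).
  rewrite -sumrMnl; apply: eq_bigr => L _.
  rewrite -sumrMnl; apply: eq_bigr => M _.
  have [dM0 | dM] := eqVneq (d M) 0.
    by rewrite dM0 mulr0 !mul0rn big1 // => x _; rewrite mul0rn mulr0.
  have [K -> [_ _ kK]] := in_RBlfP dR dM.
  rewrite -mulrnA mulnC sum_mark_comp // -sumrMnr; apply: eq_bigr => x _.
  by rewrite mulrnAl mulrnAr -mulrnA mulnC.
under eq_bigr => L _ do rewrite exchange_big.
rewrite exchange_big; apply: eq_bigr => x _ /=.
rewrite /ghost mulr_suml; apply: eq_bigr => L _.
by rewrite mulr_sumr.
Qed.
End Coefficients.
End Homs.
End Ghost.

(** * Class indicators, triangularity and divisibility of marks *)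

Section GhostProperties.
Variables (gT : finGroupType) (G : {group gT}) (R : pzRingType).
Local Notation pT := (gT * gT)%type.
Local Notation GG := (GxG G).
Local Open Scope ring_scope.
Implicit Types (c : {ffun {set pT} -> R}) (K : {group pT}) (A : {set pT}).

Lemma ghost_conj c A (v : pT) : in_RBlf G c -> v \in GG ->
  ghost G c (A :^ v) = ghost G c A.
Proof.
move=> cR vG; apply: eq_bigr => L _.
have [-> | cL] := eqVneq (c L) 0; first by rewrite !mul0rn.
by have [K -> [KG _ _]] := in_RBlfP cR cL; rewrite mark_conjr.
Qed.

Definition transitive_biset (K : {set pT}) : {ffun {set pT} -> R} :=
  [ffun L => (L == canon G K)%:R].

Lemma in_RBlf_transitive K : K \subset GG -> k1 K = 1%g ->
  in_RBlf G (transitive_biset K).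
Proof.
move=> KG kK L; rewrite ffunE; case: eqP => [-> |] // /negP[].
rewrite /is_lf_rep canon_rep //=; have [v _ ->] := canonP G K.
by rewrite k1_conj.
Qed.

Lemma ghost_transitive K A : K \subset GG ->
  ghost G (transitive_biset K) A = (mark G K A)%:R.
Proof.
move=> KG; rewrite /ghost (bigD1 (canon G K)) //= ffunE eqxx big1 ?addr0.
  by have [v vG ->] := canonP G K; rewrite mark_conjl.
by move=> L /negPf NL; rewrite ffunE NL mul0rn.
Qed.

Lemma mem_canon_class (A N : {set pT}) : is_rep G N ->
  (A \in N :^: GG) = (N == canon G A).
Proof.
move=> repN; apply/imsetP/eqP => [[v vG ->] | ->].
  by have [_ _ [_ E]] := is_repP repN; rewrite eq_canon.
by have [v vG ->] := canonP G A; exists v^-1%g; rewrite ?groupV ?conjsgK.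
Qed.

(** Expands the marks of a biset in indicators of conjugacy classes; only the class of [A]
    contributes. *)
Lemma mark_class_sum K A : K \subset GG -> A \subset GG -> group_set A ->
  mark G K A = (\sum_(N | is_rep G N) mark G K N * (A \in N :^: GG))%N.
Proof.
move=> KG AG gA; have repA := canon_rep (L := Group gA) AG.
rewrite (bigD1 (canon G A)) //= mem_canon_class // eqxx muln1 big1 ?addn0.
  by have [v vG ->] := canonP G A; rewrite mark_conjr.
by move=> N /andP[repN NA]; rewrite mem_canon_class // (negPf NA) muln0.
Qed.

Lemma k1_sub (K : {set pT}) A v : k1 K = 1%g -> group_set A -> A :^ v \subset K ->
  k1 A = 1%g.
Proof.
move=> kK gA AK; have kA : k1 (A :^ v) = 1%g.
  apply/eqP; rewrite eqEsubset -{1}kK; apply/andP; split.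
    by apply/subsetP => g; rewrite !inE; apply: (subsetP AK).
  rewrite sub1set inE; exact: (group1 (Group gA :^ v)).
by rewrite -(conjsgK v A) k1_conj.
Qed.

(** Triangularity of the table of marks, which drives the induction on [#|K|] below: a conjugate of
    [N] lies in [K], properly unless the classes agree. *)
Lemma mark_neq0_cases K (N : {set pT}) : K \subset GG -> k1 K = 1%g ->
    is_rep G N -> mark G K N != 0%N -> N != canon G K ->
  [/\ k1 N = 1%g & (#|N| < #|K|)%N].
Proof.
move=> KG kK repN /(mark_neq0 KG)[v vG NK] nNK.
have [gN _] := andP repN; split; first exact: k1_sub kK gN NK.
rewrite -(cardJg N v) proper_card // properEneq NK andbT; apply: contra nNK => /eqP E.
by have [_ _ [_ <-]] := is_repP repN; rewrite -(eq_canon N vG) E.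
Qed.

(** An element [z] centralising the image of [f] acts on the fixed points through [(z, 1)]. The
    action is free by left-freeness, so the orbits [F D] all have the order of the centraliser. *)
Lemma dvdn_mark_graph (uT : finGroupType) (f h : {ffun uT -> gT}) K :
    f \in homs G uT -> h \in homs G uT -> k1 K = 1%g ->
  (#|'C_G([set f u | u : uT])%g| %| mark G K (graph f h))%N.
Proof.
move=> fH hH kK; set C := 'C_G(_)%g; pose X := [set D in tbiset G K | fixes (graph f h) D].
pose F (D : {set pT}) := [set lcoset D (z, 1%g) | z in C].
have CG z : z \in C -> z \in G by case/setIP.
have FX D D' : D \in X -> D' \in F D -> D' \in X.
  rewrite !in_sep => /andP[DK /fixes_graphP fixD] /imsetP[z zC ->].
  rewrite lcoset_tbiset ?mem_GxG ?group1 ?CG //=; apply/fixes_graphP => u.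
  rewrite -[in RHS](fixD u) !lcosetE -!lcosetM; congr (_ *: _)%g; congr (_, _).
    by case/setIP: zC => _ /centP -> //; apply: imset_f.
  by rewrite mulg1 mul1g.
have F_eq D D' : (F D' == F D) = (D' \in F D).
  apply/eqP/idP => [<- | /imsetP[z zC ->]].
    by apply/imsetP; exists 1%g; rewrite ?group1 // lcosetE mul1g.
  apply/setP => E; apply/imsetP/imsetP => -[y yC ->].
    exists (y * z)%g; rewrite ?groupM // !lcosetE -lcosetM.
    by congr (_ *: _)%g; congr (_, _); rewrite mulg1.
  exists (y * z^-1)%g; rewrite ?groupM ?groupV // !lcosetE -lcosetM.
  by congr (_ *: _)%g; congr (_, _); rewrite /= ?mulgKV ?mulg1.
apply/dvdnP; exists #|[set y in F @: X | predT y]|; rewrite mulnC.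
rewrite -(card_fibers (f := F) predT); first by apply: eq_card => D; rewrite [RHS]in_sep andbT.
move=> _ /imsetP[D DX ->]; transitivity #|F D|.
  by apply: eq_card => D'; rewrite in_sep F_eq; apply: andb_idl => /(FX _ _ DX).
apply: card_in_imset => y z _ _; apply: (lf_free (G := G) kK).
by move: DX; rewrite in_sep => /andP[].
Qed.

Lemma ghost_graph_dvd (uT : finGroupType) (f h : {ffun uT -> gT}) c :
    in_RBlf G c -> f \in homs G uT -> h \in homs G uT ->
  exists x, ghost G c (graph f h) = x *+ #|'C_G([set f u | u : uT])%g|.
Proof.
move=> cR fH hH; set k := #|_|.
exists (\sum_L c L *+ (mark G L (graph f h) %/ k)%N).
rewrite -sumrMnl; apply: eq_bigr => L _; rewrite -mulrnA.
have [-> | cL] := eqVneq (c L) 0; first by rewrite !mul0rn.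
have [K -> [_ _ kK]] := in_RBlfP cR cL.
by rewrite divnK // dvdn_mark_graph.
Qed.

End GhostProperties.

(** * Injectivity of the ghost map, and centrality in terms of marks *)

Section CharZero.
Variables (gT : finGroupType) (G : {group gT}) (R : idomainType).
Hypothesis char0 : [pchar {fraction R}]%R =i pred0.
Local Notation pT := (gT * gT)%type.
Local Notation GG := (GxG G).
Local Open Scope ring_scope.

(* Among the subgroups in the support of [c], a largest one detects only itself. *)
Lemma ghost_inj (c : {ffun {set pT} -> R}) :
    in_RBlf G c ->
    (forall K : {group pT}, K \subset GG -> k1 K = 1%g -> ghost G c K = 0) ->
  c = [ffun=> 0].
Proof.
move=> cR gc0; apply/ffunP => L0; rewrite ffunE; apply/eqP/negPn/negP => cL0.
have [L cL maxL] := @arg_maxnP _ L0 (fun L => c L != 0) (fun L : {set pT} => #|L|) cL0.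
have [K DL [KG cK kK]] := in_RBlfP cR cL.
rewrite DL in cL maxL KG cK kK.
have := gc0 K KG kK; rewrite /ghost (bigD1 (K : {set pT})) //= big1 ?addr0; last first.
  move=> M NM; have [-> | cM] := eqVneq (c M) 0; first by rewrite mul0rn.
  have [N DM [NG cN kN]] := in_RBlfP cR cM; rewrite DM in cM NM NG cN *.
  (* A conjugate of [K] inside [N] fills [N] by maximality of [#|K|], and canonical representatives
     of one class coincide. *)
  apply/eqP; have [-> // | /(mark_neq0 NG)[v vG KN]] := eqVneq (mark G N K) 0%N.
  case/eqP: NM; rewrite -cN -cK -(eq_canon K vG); congr (canon G _); apply/esym/eqP.
  by rewrite eqEcard KN cardJg; apply: maxL.
move/eqP; rewrite -mulr_natr mulf_eq0 (negPf cL) char0_natr_eq0 //=.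
by rewrite eqn0Ngt mark_refl_gt0.
Qed.

Variable e : {ffun {set pT} -> R}.
Hypothesis eR : in_RBlf G e.
Hypothesis e_central :
  forall x : {ffun {set pT} -> R}, in_RBlf G x -> bmul G e x = bmul G x e.

(** Commuting with the biset of [K] gives a combination of these identities over all classes [N],
    weighted by [mark G K N]. Induction on [#|K|] removes the smaller classes, and the weight
    [mark G K K] of the remaining one cancels in characteristic 0. *)
Lemma central_ghost_class (uT : finGroupType) (f h : {ffun uT -> gT})
    (K : {group pT}) :
    f \in homs G uT -> h \in homs G uT -> K \subset GG -> k1 K = 1%g ->
  \sum_(x in homs G uT) ghost G e (graph f x) *+ (graph x h \in K :^: GG)
    = \sum_(x in homs G uT) ghost G e (graph x h) *+ (graph f x \in K :^: GG).
Proof.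
move=> fH hH; pose S1 (N : {set pT}) :=
  \sum_(x in homs G uT) ghost G e (graph f x) *+ (graph x h \in N :^: GG).
pose S2 (N : {set pT}) :=
  \sum_(x in homs G uT) ghost G e (graph x h) *+ (graph f x \in N :^: GG).
rewrite -/(S1 K) -/(S2 K).
have [n] := ubnP #|K|; elim: n K => // n IHn K; rewrite ltnS => leKn KG kK.
have XR := in_RBlf_transitive R KG kK.
have mE x y : x \in homs G uT -> y \in homs G uT ->
    (mark G K (graph x y)) = (\sum_(N | is_rep G N) mark G K N * (graph x y \in N :^: GG))%N.
  by move=> xH yH; apply: mark_class_sum; rewrite ?graph_sub ?(graph_group_set xH yH).
have sumS : \sum_(N | is_rep G N) S1 N *+ mark G K N
          = \sum_(N | is_rep G N) S2 N *+ mark G K N.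
  have := congr1 (fun c => ghost G c (graph f h) *+ #|G|) (e_central XR).
  rewrite !ghost_bmul // => E.
  transitivity (\sum_(x in homs G uT)
      ghost G e (graph f x) * ghost G (transitive_biset G R K) (graph x h)).
    under eq_bigr => N _ do rewrite -sumrMnl.
    rewrite exchange_big; apply: eq_bigr => x xH /=.
    rewrite ghost_transitive // mE // mulr_natr -sumrMnr.
    by apply: eq_bigr => N _; rewrite -mulrnA mulnC.
  rewrite E; under [RHS]eq_bigr => N _ do rewrite -sumrMnl.
  rewrite [RHS]exchange_big; apply: eq_bigr => x xH /=.
  rewrite ghost_transitive // mE // mulr_natl -sumrMnr.
  by apply: eq_bigr => N _; rewrite -mulrnA mulnC.
have repK := canon_rep KG.
have classK : canon G K :^: GG = K :^: GG.
  apply/setP => A; rewrite mem_canon_class //; have [v vG E] := canonP G K.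
  apply/eqP/imsetP => [EA | [w wG ->]]; last by rewrite eq_canon.
  have [w wG Ew] := canonP G A; exists (v * w^-1)%g; first by rewrite groupM ?groupV.
  by rewrite conjsgM -E EA Ew conjsgK.
have markK : mark G K (canon G K) = mark G K K.
  by have [v vG ->] := canonP G K; rewrite mark_conjr.
have SK1 : S1 (canon G K) = S1 K by rewrite /S1 classK.
have SK2 : S2 (canon G K) = S2 K by rewrite /S2 classK.
move: sumS; rewrite (bigD1 (canon G K)) //= [in RHS](bigD1 (canon G K)) //=.
rewrite (eq_bigr (fun N => S2 N *+ mark G K N)) => [/addIr |].
  by rewrite markK SK1 SK2; apply: char0_mulrn_inj; rewrite ?mark_refl_gt0.
move=> N /andP[repN NK].
have [-> | mN] := eqVneq (mark G K N) 0%N; first by rewrite !mulr0n.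
have [kN ltN] := mark_neq0_cases KG kK repN mN NK.
have [N' DN [NG _]] := is_repP repN; rewrite DN in kN ltN NG *.
by rewrite IHn // (leq_trans ltN).
Qed.

End CharZero.

(** * Injective homomorphisms with image conjugate to a given one *)

Section Block.
Variables (gT : finGroupType) (G : {group gT}) (uT : finGroupType).
Local Notation pT := (gT * gT)%type.
Local Notation GG := (GxG G).
Local Notation Hom := (homs G uT).
Implicit Types (f h x : {ffun uT -> gT}).

Definition conjf f (g : gT) : {ffun uT -> gT} := [ffun u => f u ^ g].
Definition conjfs f : {set {ffun uT -> gT}} := conjf f @: G.
Definition im f : {set gT} := [set f u | u : uT].

Lemma conjf1 f : conjf f 1 = f.
Proof. by apply/ffunP => u; rewrite ffunE conjg1. Qed.

Lemma conjfM f a b : conjf f (a * b) = conjf (conjf f a) b.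
Proof. by apply/ffunP => u; rewrite !ffunE conjgM. Qed.

Lemma conjf_homs f g : f \in Hom -> g \in G -> conjf f g \in Hom.
Proof.
move=> fH gG; apply/homsP; split=> [u | u v]; rewrite !ffunE.
  by rewrite groupJ // (homs_in _ fH).
by rewrite (homsM fH) conjMg.
Qed.

Lemma graph_conjf f h a b : graph (conjf f a) (conjf h b) = graph f h :^ (a, b).
Proof.
rewrite /graph /conjugate -imset_comp; apply: eq_imset => u /=.
by rewrite !ffunE.
Qed.

Lemma im_group_set f : f \in Hom -> group_set (im f).
Proof.
move=> fH; apply/group_setP; split=> [|_ _ /imsetP[u _ ->] /imsetP[v _ ->]].
  by apply/imsetP; exists 1; rewrite ?(homs1 fH).
by apply/imsetP; exists (u * v); rewrite ?(homsM fH).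
Qed.

(** Orbit-stabiliser for conjugation: the stabiliser of [f] is the centraliser of its image. *)
Lemma card_conjfs f : (#|'C_G(im f)| * #|conjfs f| = #|G|)%N.
Proof.
have -> : #|conjfs f| = #|[set y in conjf f @: G | predT y]|.
  by apply: eq_card => y; rewrite in_sep andbT.
rewrite -(card_fibers (f := conjf f) predT).
  by apply: eq_card => y; rewrite in_sep andbT.
move=> _ /imsetP[g gG ->]; rewrite -[RHS](card_rcoset _ g); apply: eq_card => a.
rewrite in_sep mem_rcoset in_setI groupMr ?groupV //; apply: andb_id2l => aG.
apply/eqP/centP => [E _ /imsetP[u _ ->] | cf].
  apply: commute_sym; apply/commgP/conjg_fixP; rewrite conjgM.
  by move/ffunP/(_ u): E; rewrite !ffunE => ->; rewrite conjgK.
apply/ffunP => u; rewrite !ffunE -[a in LHS](mulgKV g) conjgM.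
by congr (_ ^ _); apply/conjg_fixP/commgP/commute_sym/cf/imset_f.
Qed.

Lemma card_conjfs_gt0 f : 0 < #|conjfs f|.
Proof. by have := cardG_gt0 G; rewrite -(card_conjfs f) muln_gt0 => /andP[]. Qed.

Lemma conjfs_self f : f \in conjfs f.
Proof. by apply/imsetP; exists 1; rewrite ?conjf1. Qed.

Lemma conjfs_sym f h : (f \in conjfs h) = (h \in conjfs f).
Proof.
suff {f h} imp f h : f \in conjfs h -> h \in conjfs f by apply/idP/idP; apply: imp.
case/imsetP=> g gG ->; apply/imsetP; exists g^-1; rewrite ?groupV //.
by rewrite -conjfM mulgV conjf1.
Qed.

Section FixedInclusion.
Variable i : {ffun uT -> gT}.
Hypotheses (iH : i \in Hom) (i_inj : injective i).

(** Only containment of the image in a conjugate of [im i] is asked; with injectivity, cardinality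
    forces equality. *)
Definition block : {set {ffun uT -> gT}} :=
  [set x in Hom | injectiveb x &
    [exists b in G, forall u, exists w, x u == i w ^ b]].

Lemma blockP x : x \in Hom ->
  reflect (injective x /\ exists2 b, b \in G & forall u, exists w, x u = i w ^ b)
          (x \in block).
Proof.
move=> xH; rewrite inE xH /=; apply: (iffP andP) => -[].
  move=> /injectiveP x_inj /exists_inP[b bG /forallP xb]; split=> //; exists b => // u.
  by have /existsP[w /eqP] := xb u; exists w.
move=> x_inj [b bG xb]; split; first exact/injectiveP.
apply/exists_inP; exists b => //; apply/forallP => u.
by have [w xu] := xb u; apply/existsP; exists w; apply/eqP.
Qed.

Lemma block_homs x : x \in block -> x \in Hom.
Proof. by rewrite inE => /andP[]. Qed.

Lemma block_self : i \in block.
Proof.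
apply/blockP => //; split=> //; exists 1; rewrite ?group1 // => u.
by exists u; rewrite conjg1.
Qed.

Lemma im_block x : x \in block -> exists2 b, b \in G & im x = im i :^ b.
Proof.
move=> xI; have /(blockP (block_homs xI))[x_inj [b bG xb]] := xI.
exists b => //; apply/eqP; rewrite eqEcard cardJg !card_imset // leqnn andbT.
apply/subsetP => _ /imsetP[u _ ->]; have [w ->] := xb u.
by rewrite memJ_conjg imset_f.
Qed.

Lemma block_conjf x g : x \in block -> g \in G -> conjf x g \in block.
Proof.
move=> xI gG; have /(blockP (block_homs xI))[x_inj [b bG xb]] := xI.
apply/blockP; first exact: conjf_homs (block_homs xI) gG.
split=> [u v | ]; first by rewrite !ffunE => /conjg_inj /x_inj.
exists (b * g); first exact: groupM.
by move=> u; have [w E] := xb u; exists w; rewrite ffunE E conjgM.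
Qed.

Lemma card_conjfs_block x : x \in block -> #|conjfs x| = #|conjfs i|.
Proof.
case/im_block=> b bG E; have := card_conjfs x.
have -> : 'C_G(im x) = 'C_G(im i) :^ b by rewrite E conjIg conjGid // centJ.
by rewrite cardJg -(card_conjfs i) => /eqP; rewrite eqn_pmul2l ?cardG_gt0 // => /eqP.
Qed.

(** Since [i] is injective, [graph i' i] has [#|uT|] elements. Comparing cardinalities makes [u]
    recoverable from [(f u, h u)] in one direction, and upgrades containment of graphs to equality
    in the other. *)
Lemma graph_classP (i' f h : {ffun uT -> gT}) :
    i' \in Hom -> f \in Hom -> h \in Hom ->
  reflect (exists a b, [/\ a \in G, b \in G, injective h
             & forall u, exists w, f u = i' w ^ a /\ h u = i w ^ b])
          (graph f h \in graph i' i :^: GG).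
Proof.
move=> i'H fH hH.
have card_i : #|graph i' i| = #|uT| by rewrite card_imset // => u v [_ /i_inj].
apply: (iffP imsetP) => [[[a b]] | [a [b [aG bG h_inj fhE]]]].
  rewrite mem_GxG => /andP[aG bG] E.
  have fhE u : exists w, f u = i' w ^ a /\ h u = i w ^ b.
    have: (f u, h u) \in graph i' i :^ (a, b) by rewrite -E imset_f.
    by case/imsetP=> _ /imsetP[w _ ->] [-> ->]; exists w.
  exists a, b; split=> // u v Ehuv.
  have pair_inj : {in uT &, injective (fun u => (f u, h u))}.
    by apply/imset_injP; rewrite -/(graph f h) E cardJg card_i.
  apply/eqP; rewrite eq_mulgV1; apply/eqP; set z := u * v^-1.
  have hz : h z = 1.
    by apply: (mulIg (h v)); rewrite -(homsM hH) mulgKV mul1g.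
  (* As [h z = 1], the parameter [w] of [z] is trivial, so [f z = 1] too and [z] has the same pair
     as [1]. *)
  apply: pair_inj; rewrite ?inE // hz (homs1 fH) (homs1 hH); congr (_, _).
  have [w [-> Ehz]] := fhE z; rewrite (_ : w = 1) ?(homs1 i'H) ?conj1g //.
  by apply: i_inj; apply: (conjg_inj b); rewrite -Ehz hz (homs1 iH) conj1g.
exists (a, b); first by rewrite mem_GxG aG bG.
apply/eqP; rewrite eqEcard cardJg card_i card_imset ?leqnn ?andbT; last first.
  by move=> u v [_ /h_inj].
apply/subsetP => _ /imsetP[u _ ->]; have [w [-> ->]] := fhE u.
by rewrite -[(_, _)]/((i' w, i w) ^ (a, b)) memJ_conjg imset_f.
Qed.

(** As a matrix, this indicator divided by [#|conjfs i|] averages over [G]-orbits in the block and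
    is zero elsewhere. *)
Lemma graph_ii_class f h : f \in Hom -> h \in Hom ->
  (graph f h \in graph i i :^: GG) = (h \in block) && (f \in conjfs h).
Proof.
move=> fH hH; apply/(graph_classP iH fH hH)/andP.
  case=> a [b [aG bG h_inj fhE]]; split.
    apply/blockP => //; split=> //; exists b => // u.
    by have [w [_]] := fhE u; exists w.
  apply/imsetP; exists (b^-1 * a); first by rewrite groupM ?groupV.
  apply/ffunP => u; rewrite ffunE; have [w [-> ->]] := fhE u.
  by rewrite conjgM conjgK.
case=> /(blockP hH)[h_inj [b bG hE]] /imsetP[g gG ->].
exists (b * g), b; rewrite groupM //; split=> // u.
by have [w E] := hE u; exists w; rewrite ffunE E conjgM.
Qed.

Lemma graph_ii_class_sym f h : f \in Hom -> h \in Hom ->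
  (graph f h \in graph i i :^: GG) = (graph h f \in graph i i :^: GG).
Proof.
move=> fH hH; rewrite !graph_ii_class // conjfs_sym.
apply: andb_id2r => /imsetP[g gG E]; apply/idP/idP => [hI | fI].
  have -> : f = conjf h g^-1 by rewrite E -conjfM mulgV conjf1.
  by rewrite block_conjf ?groupV.
by rewrite E block_conjf.
Qed.

Definition triv : {ffun uT -> gT} := [ffun => 1].

Lemma triv_homs : triv \in Hom.
Proof. by apply/homsP; split=> [u|u v]; rewrite !ffunE ?mulg1. Qed.

(** The indicator of the class of [1 x im i] has a single nonzero row, so multiplying by it produces
    column sums. *)
Lemma graph_1i_class f h : f \in Hom -> h \in Hom ->
  (graph f h \in graph triv i :^: GG) = (h \in block) && (f == triv).
Proof.
move=> fH hH; apply/(graph_classP triv_homs fH hH)/andP.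
  case=> a [b [aG bG h_inj fhE]]; split.
    apply/blockP => //; split=> //; exists b => // u.
    by have [w [_]] := fhE u; exists w.
  apply/eqP/ffunP => u; have [w [-> _]] := fhE u.
  by rewrite !ffunE conj1g.
case=> /(blockP hH)[h_inj [b bG hE]] /eqP ->.
exists 1, b; split=> // u; have [w E] := hE u; exists w.
by rewrite !ffunE conj1g.
Qed.

Lemma k1_graph_inj f : f \in Hom -> k1 (graph f i) = 1.
Proof.
move=> fH; apply/setP => g; rewrite !inE; apply/imsetP/eqP => [[u _ [-> E]] | ->].
  by rewrite (_ : u = 1) ?(homs1 fH) //; apply: i_inj; rewrite (homs1 iH).
by exists 1; rewrite ?(homs1 fH) ?(homs1 iH).
Qed.

(** * The restriction of a central idempotent to one block *)

Section CentralIdempotent.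
Variable R : idomainType.
Hypothesis char0 : [pchar {fraction R}]%R =i pred0.
Variable e : {ffun {set pT} -> R}.
Hypotheses (eR : in_RBlf G e) (e_idem : bmul G e e = e).
Hypothesis e_central :
  forall x : {ffun {set pT} -> R}, in_RBlf G x -> bmul G e x = bmul G x e.
Local Open Scope ring_scope.

Local Notation n f h := (ghost G e (graph f h)).
Local Notation D f h := (graph f h \in graph i i :^: GG).
Local Notation c := #|conjfs i|.
Local Notation k := #|'C_G(im i)%g|.

(** An invariant [w] is constant on conjugacy orbits, and those in the block all have [#|conjfs i|]
    elements; so summing against [D] rescales [w] and cuts it off outside the block. *)
Lemma sum_class (w : {ffun uT -> gT} -> R) f :
    f \in Hom -> (forall x g, x \in Hom -> g \in G -> w (conjf x g) = w x) ->
  \sum_(x in Hom) w x *+ D x f = w f *+ (c * (f \in block)).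
Proof.
move=> fH w_conj; transitivity (\sum_(x in Hom | D x f) w x).
  by rewrite big_mkcondr; apply: eq_bigr => x _; case: (D x f).
have [fI | fI] := boolP (f \in block); last first.
  rewrite muln0 big1 // => x /andP[xH]; rewrite graph_ii_class //.
  by rewrite (negPf fI).
transitivity (\sum_(x in conjfs f) w f).
  apply: eq_big => [x | x /andP[xH]].
    apply/andP/idP => [[xH] | xf]; first by rewrite graph_ii_class // => /andP[].
    have xH : x \in Hom by case/imsetP: xf => g gG ->; apply: conjf_homs.
    by rewrite graph_ii_class // fI.
  by rewrite graph_ii_class // => /andP[_ /imsetP[g gG ->]]; rewrite w_conj.
by rewrite sumr_const card_conjfs_block // muln1.
Qed.

Lemma n_conj f h a b : a \in G -> b \in G -> n (conjf f a) (conjf h b) = n f h.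
Proof. by move=> aG bG; rewrite graph_conjf ghost_conj // mem_GxG aG. Qed.

Lemma n_conjl f h g : g \in G -> n (conjf f g) h = n f h.
Proof. by move=> gG; rewrite -{1}(conjf1 h) n_conj. Qed.

Lemma n_conjr f h g : g \in G -> n f (conjf h g) = n f h.
Proof. by move=> gG; rewrite -{1}(conjf1 f) n_conj. Qed.

Lemma nn f h : f \in Hom -> h \in Hom ->
  \sum_(x in Hom) n f x * n x h = n f h *+ #|G|.
Proof. by move=> fH hH; rewrite -{3}e_idem ghost_bmul. Qed.

(** Multiplying by [D] on the right keeps [n f h], up to the factor [c], only if [h] is in the
    block; on the left, only if [f] is. Centrality equates the two products. *)
Lemma n_off_block f h : f \in Hom -> h \in Hom ->
  (f \in block) != (h \in block) -> n f h = 0.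
Proof.
move=> fH hH fh.
have := @central_ghost_class _ _ _ char0 _ eR e_central _ f h (Group (graph_group_set iH iH))
  fH hH (graph_sub iH iH) (k1_graph_inj iH).
rewrite /= (sum_class hH); last by move=> x g _ gG; apply: n_conjr.
under [X in _ = X]eq_bigr => x xH do rewrite graph_ii_class_sym //.
rewrite (sum_class fH); last by move=> x g _ gG; apply: n_conjl.
move: fh; case: (f \in block); case: (h \in block) => //= _;
  rewrite ?muln0 ?muln1 ?mulr0n => /eqP; rewrite 1?eq_sym => /eqP E;
  apply: (char0_mulrn_inj char0 (card_conjfs_gt0 i)); rewrite mul0rn //.
Qed.

(** Compare the products with the class of [graph triv i] at [(triv, i)]: one retains only
    [x = triv], the other every [x] in the block. *)
Lemma sum_block_column : \sum_(x in block) n x i = n triv triv.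
Proof.
have := @central_ghost_class _ _ _ char0 _ eR e_central _ triv i
  (Group (graph_group_set triv_homs iH)) triv_homs iH
  (graph_sub triv_homs iH) (k1_graph_inj triv_homs).
rewrite /=; under eq_bigr => x xH do rewrite graph_1i_class // block_self.
rewrite (bigD1 triv triv_homs) /= eqxx mulr1n big1 ?addr0; last first.
  by move=> x /andP[_ /negPf ->].
under eq_bigr => x xH do rewrite graph_1i_class ?triv_homs // eqxx andbT.
move=> ->; rewrite big_mkcond [RHS]big_mkcond; apply: eq_bigr => x _.
have [xI | xI] := boolP (x \in block); first by rewrite block_homs.
by case: ifP.
Qed.

(** Extension by zero to all functions, so that [sum_diag_quasi_idempotent] applies with a finite
    type of indices. *)
Definition blk (w : {ffun uT -> gT} -> {ffun uT -> gT} -> R) f h : R :=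
  if (f \in block) && (h \in block) then w f h else 0.

Lemma blk_mul w1 w2 f h :
  \sum_x blk w1 f x * blk w2 x h =
    if (f \in block) && (h \in block) then \sum_(x in block) w1 f x * w2 x h
    else 0.
Proof.
rewrite /blk; case: ifP => [/andP[-> ->] | fh].
  rewrite [RHS]big_mkcond; apply: eq_bigr => x _; rewrite andbT /=.
  by case: (x \in block); rewrite ?mulr0.
apply: big1 => x _; move: fh; case: (f \in block); rewrite /= ?mul0r // => ->.
by rewrite andbF mulr0.
Qed.

Lemma blk_trace w :
  \sum_x blk w x x = \sum_(x in block) w x x.
Proof.
by rewrite [RHS]big_mkcond; apply: eq_bigr => x _; rewrite /blk andbb.
Qed.

Lemma big_block (w : {ffun uT -> gT} -> R) :
    (forall x, x \in Hom -> x \notin block -> w x = 0) ->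
  \sum_(x in block) w x = \sum_(x in Hom) w x.
Proof.
move=> w0; rewrite big_mkcond [RHS]big_mkcond; apply: eq_bigr => x _.
have [xI | xI] := boolP (x \in block); first by rewrite block_homs.
by case: ifP => // xH; rewrite w0.
Qed.

Lemma n_blk_mul f h :
  \sum_x blk (fun f h => n f h) f x * blk (fun f h => n f h) x h
    = blk (fun f h => n f h) f h *+ #|G|.
Proof.
rewrite blk_mul /blk; case: ifP => [/andP[fI hI] | _]; last by rewrite mul0rn.
rewrite big_block ?nn ?block_homs // => x xH xI.
by rewrite (n_off_block (block_homs fI) xH) ?mul0r // fI (negPf xI).
Qed.

(** On the block, [#|G|] times the idempotent complementary to [e] in the projector [k D / #|G|]
    onto invariants. *)
Definition compl f h : R := (k * D f h)%:R - n f h.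

Lemma D_conjl f h g : f \in Hom -> h \in Hom -> g \in G -> D (conjf f g) h = D f h.
Proof.
move=> fH hH gG; rewrite !graph_ii_class ?conjf_homs //; congr (_ && _).
by rewrite [LHS]conjfs_sym [RHS]conjfs_sym; apply/imsetP/imsetP => -[a aG ->];
  [exists (g * a)%g | exists (g^-1 * a)%g]; rewrite ?groupM ?groupV // -?conjfM ?mulKVg.
Qed.

(** As [c * k = #|G|], multiplication by [k D] scales the block by [#|G|] on either side. Hence
    [k D] scales [compl] by [#|G|], while [n] annihilates it. *)
Lemma compl_blk_mul f h :
  \sum_x blk compl f x * blk compl x h = blk compl f h *+ #|G|.
Proof.
rewrite blk_mul /blk; case: ifP => [/andP[fI hI] | _]; last by rewrite mul0rn.
have [fH hH] := (block_homs fI, block_homs hI).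
have E : (c * k = #|G|)%N by rewrite mulnC card_conjfs.
have compl_conj x g : x \in Hom -> g \in G -> compl (conjf x g) h = compl x h.
  by move=> xH gG; rewrite /compl D_conjl // n_conjl.
have sum1 : \sum_(x in Hom) (k * D f x)%:R * compl x h = compl f h *+ #|G|.
  transitivity ((\sum_(x in Hom) compl x h *+ D x f) *+ k).
    rewrite -sumrMnl; apply: eq_bigr => x xH.
    by rewrite -mulrnA mulr_natl mulnC graph_ii_class_sym.
  by rewrite sum_class // fI muln1 -mulrnA E.
have sum2 : \sum_(x in Hom) n f x * compl x h = 0.
  rewrite /compl; under eq_bigr => x _ do rewrite mulrBr.
  rewrite sumrB nn //.
  transitivity ((\sum_(x in Hom) n f x *+ D x h) *+ k - n f h *+ #|G|).
    congr (_ - _); rewrite -sumrMnl; apply: eq_bigr => x xH.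
    by rewrite -mulrnA mulr_natr mulnC.
  rewrite sum_class // => [|x g _ gG]; last exact: n_conjr.
  by rewrite hI muln1 -mulrnA E subrr.
rewrite big_block => [|x xH xI]; last first.
  rewrite {1}/compl (n_off_block fH xH) ?fI ?xI // graph_ii_class //.
  by rewrite (negPf xI) muln0 subrr mul0r.
under eq_bigr => x _ do rewrite {1}/compl mulrBl.
by rewrite sumrB sum1 sum2 subr0.
Qed.

Lemma n_diag f : f \in block -> n f f = n i i.
Proof.
move=> fI; have fH := block_homs fI.
have: D f f by rewrite graph_ii_class // fI conjfs_self.
by case/imsetP=> v vG ->; rewrite ghost_conj.
Qed.

(** The blocks of [n] and [compl] have ranks [r] and [s] with [r + s = N]. Writing [n i i = k y],
    the trace gives [N y = r], so the assumption on primes leaves [r = 0] or [s = 0]. The matrix of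
    rank 0 vanishes, which determines the column of [i]. *)
Lemma block_alternative (N : nat) :
    (N * #|G| = #|block| * k)%N ->
    (forall p : nat, prime p -> (p %| N)%N -> p%:R \isn't a @GRing.unit R) ->
  (n triv triv = 0 /\ forall f, f \in Hom -> n f i = 0) \/
  (n triv triv = #|G|%:R /\ forall f, f \in Hom -> n f i = (k * D f i)%:R).
Proof.
move=> DN nonunit; have G_gt0 := cardG_gt0 G.
have [y Dy] := ghost_graph_dvd eR iH iH.
have [r tr1 r0] := sum_diag_quasi_idempotent char0 G_gt0 n_blk_mul.
have [s tr2 s0] := sum_diag_quasi_idempotent char0 G_gt0 compl_blk_mul.
rewrite blk_trace (eq_bigr (fun=> n i i)) in tr1; last exact: n_diag.
rewrite blk_trace (eq_bigr (fun=> k%:R - n i i)) in tr2; last first.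
  move=> f fI; rewrite /compl n_diag // graph_ii_class ?block_homs // fI conjfs_self.
  by rewrite muln1.
have yN : y *+ N = r%:R.
  apply: (char0_mulrn_inj char0 G_gt0); rewrite -mulrnA DN mulnC mulrnA -Dy.
  by rewrite -sumr_const tr1 natrM mulr_natl.
have rs : (N = r + s)%N.
  apply/eqP; rewrite -(eqn_pmul2r G_gt0) DN; apply/eqP/(char0_natr_inj char0).
  rewrite mulnDl natrD ![(_ * #|G|)%N]mulnC -tr1 -tr2 -big_split /=.
  by under eq_bigr => f _ do rewrite addrC subrK; rewrite sumr_const natrM mulr_natl.
have N_gt0 : (0 < N)%N.
  have: (0 < #|block| * k)%N.
    by rewrite muln_gt0 cardG_gt0 andbT; apply/card_gt0P; exists i; apply: block_self.
  by rewrite -DN muln_gt0 => /andP[].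
have off f : f \in Hom -> f \notin block -> n f i = 0.
  by move=> fH fI; apply: n_off_block; rewrite // block_self (negPf fI).
have rN : (r <= N)%N by rewrite rs leq_addr.
have [r_0 | r_N] := mulrn_eq_natr_cases char0 N_gt0 rN nonunit yN.
  have n0 f : f \in Hom -> n f i = 0.
    move=> fH; have [fI | fI] := boolP (f \in block); last exact: off.
    by have := r0 r_0 f i; rewrite /blk fI block_self.
  left; split=> //; rewrite -sum_block_column big1 // => x xI.
  exact/n0/block_homs.
have s_0 : s = 0%N by apply/eqP; rewrite -(eqn_add2l r) -rs addn0 r_N.
have nD f : f \in Hom -> n f i = (k * D f i)%:R.
  move=> fH; have [fI | fI] := boolP (f \in block); last first.
    by rewrite off // graph_ii_class_sym // graph_ii_class // (negPf fI) muln0.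
  by have := s0 s_0 f i; rewrite /blk fI block_self => /subr0_eq.
(* The column of [k D] at [i] has [c] nonzero entries equal to [k], with sum [#|G|]. *)
right; split=> //; rewrite -sum_block_column.
rewrite (eq_bigr (fun x => (1 *+ D x i) *+ k)) => [|x xI]; last first.
  by rewrite nD ?block_homs // mulnC natrM mulr_natr.
rewrite sumrMnl big_block => [|x xH xI]; last first.
  by rewrite graph_ii_class_sym // graph_ii_class // (negPf xI).
by rewrite (sum_class (w := fun=> 1)) // block_self muln1 -mulrnA mulnC card_conjfs.
Qed.

End CentralIdempotent.
End FixedInclusion.
End Block.

(** * The size of a block in terms of automorphisms *)

Section BlockCount.
Variables (gT : finGroupType) (G : {group gT}) (uT : finGroupType).
Variable i : {ffun uT -> gT}.
Hypotheses (iH : i \in homs G uT) (i_inj : injective i).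

Let U : {group gT} := Group (im_group_set iH).

Lemma im_sub : U \subset G.
Proof. by apply/subsetP => _ /imsetP[u _ ->]; apply: homs_in iH. Qed.

Lemma homs_embedding_aut (y : {ffun uT -> gT}) :
    y \in homs G uT -> injective y -> (forall u, y u \in U) ->
  exists2 a, a \in Aut U & forall u, a (i u) = y u.
Proof.
move=> yH y_inj yU; pose m z := y (odflt 1 [pick u | i u == z]).
have m_i u : m (i u) = y u.
  rewrite /m; case: pickP => [w /eqP/i_inj -> //|/(_ u)]; by rewrite eqxx.
have mM : {in U &, {morph m : v w / v * w}}.
  by move=> _ _ /imsetP[u _ ->] /imsetP[v _ ->]; rewrite -(homsM iH) !m_i (homsM yH).
pose f := Morphism mM.
have f_inj : 'injm f.
  apply/injmP => _ _ /imsetP[u _ ->] /imsetP[v _ ->] /=.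
  by rewrite !m_i => /y_inj ->.
have fU : f @* U = U.
  apply/eqP; rewrite eqEcard card_injm // leqnn andbT.
  by apply/subsetP => _ /morphimP[_ _ /imsetP[u _ ->] ->] /=; rewrite m_i.
exists (aut f_inj fU); first exact: Aut_aut.
by move=> u; rewrite autE ?imset_f //= m_i.
Qed.

Lemma card_block_normaliser : (#|'N_G(U)| * #|block G i| = #|Aut U| * #|G|)%N.
Proof.
pose F (p : {perm gT} * gT) : {ffun uT -> gT} := [ffun u => p.1 (i u) ^ p.2].
have iU u : i u \in U by apply: imset_f.
have FE : F @: setX (Aut U) G = block G i.
  apply/setP => x; apply/imsetP/idP => [[[a g] /setXP[aA gG] ->] | xI].
    have aiU u : a (i u) \in U by rewrite Aut_closed.
    apply/blockP.
      apply/homsP; split=> [u | u v]; rewrite !ffunE /=.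
        by rewrite groupJ // (subsetP im_sub).
      by rewrite (homsM iH) -conjMg (morphicP (Aut_morphic aA)).
    split=> [u v | ]; first by rewrite !ffunE => /conjg_inj/perm_inj/i_inj.
    exists g => // u; have /imsetP[w _ E] := aiU u.
    by exists w; rewrite ffunE /= E.
  have xH := block_homs xI; have /(blockP _ xH)[x_inj [b bG xb]] := xI.
  have [||u|a aA aE] := @homs_embedding_aut (conjf x b^-1).
  - by apply: conjf_homs; rewrite ?groupV.
  - by move=> u v; rewrite !ffunE => /conjg_inj/x_inj.
  - by have [w E] := xb u; rewrite ffunE E conjgK.
  exists (a, b); first by rewrite in_setX aA bG.
  by apply/ffunP => u; rewrite ffunE /= aE ffunE conjgKV.
rewrite -FE -[RHS]cardsX.
have -> : #|setX (Aut U) G| = #|[set p in setX (Aut U) G | predT (F p)]|.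
  by apply: eq_card => p; rewrite in_sep andbT.
have -> : #|F @: setX (Aut U) G| = #|[set y in F @: setX (Aut U) G | predT y]|.
  by apply: eq_card => p; rewrite in_sep andbT.
rewrite (card_fibers (f := F) predT (k := #|'N_G(U)|)) //.
move=> _ /imsetP[[a0 g0] /setXP[aA0 gG0] ->].
pose P (z : gT) := (a0 * conj_aut U z, z^-1 * g0).
rewrite -(card_in_imset (f := P) (D := 'N_G(U))); last first.
  by move=> y z _ _ [_ /mulIg /invg_inj].
apply: eq_card => -[a g]; rewrite in_sep; apply/andP/imsetP.
  case=> /setXP[aA gG] /eqP/ffunP E.
  have aE u : a (i u) = a0 (i u) ^ (g0 * g^-1).
    by have := E u; rewrite !ffunE /= conjgM => <-; rewrite conjgK.
  have zN : g0 * g^-1 \in 'N_G(U).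
    rewrite in_setI groupM ?groupV //= inE; apply/subsetP => _ /imsetP[w wU ->].
    have /imsetP[u _ Eu] : a0^-1 w \in U by rewrite Aut_closed ?groupV.
    by rewrite -(permKV a0 w) Eu -aE; apply: Aut_closed aA _ (iU u).
  exists (g0 * g^-1) => //; rewrite /P invMg invgK mulgKV; congr (_, _).
  have [_ zNU] := setIP zN.
  apply: (eq_Aut aA); first by rewrite groupM // Aut_aut.
  by move=> _ /imsetP[u _ ->]; rewrite permM norm_conj_autE ?Aut_closed ?iU.
case=> z /setIP[zG zN] [-> ->]; split.
  apply/setXP; split; last by rewrite groupM ?groupV.
  by rewrite groupM // (subsetP (Aut_conj_aut U 'N(U))) // mem_morphim.
apply/eqP/ffunP => u; rewrite !ffunE /= permM norm_conj_autE ?Aut_closed //.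
by rewrite -conjgM mulKVg.
Qed.

Definition relative_Out_order : nat := #|Aut U : conj_aut U @* 'N_G(U)|.

Lemma card_block : (relative_Out_order * #|G| = #|block G i| * #|'C_G(im i)|)%N.
Proof.
have autG : conj_aut U @* 'N_G(U) \subset Aut U := Aut_conj_aut U 'N_G(U).
have card_autG : (#|'C_G(U)| * #|conj_aut U @* 'N_G(U)| = #|'N_G(U)|)%N.
  rewrite card_morphim ker_conj_aut -(LagrangeI 'N_G(U) 'C(U)).
  by rewrite (setIidPr (subsetIr _ _)) -setIA (setIidPr (cent_sub U)).
apply/eqP; rewrite -(eqn_pmul2l (cardG_gt0 (conj_aut U @* 'N_G(U)))).
rewrite mulnA (Lagrange autG) -card_block_normaliser -card_autG.
by apply/eqP; rewrite -[LHS]mulnA [LHS]mulnC [RHS]mulnA.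
Qed.

Lemma dvdn_relative_Out_order : relative_Out_order %| Out_order U.
Proof.
rewrite /Out_order -(Lagrange_index (Aut_conj_aut U 'N_G(U)) (K := Group (groupP (conj_aut U @* U)))).
  exact: dvdn_mulr.
by apply: morphimS; rewrite subsetI im_sub normG.
Qed.

End BlockCount.

Section Identity.
Variables (gT : finGroupType) (G : {group gT}).
Local Notation pT := (gT * gT)%type.
Local Notation GG := (GxG G).

Lemma diagG_group_set : group_set (diagG G).
Proof.
apply/group_setP; split=> [|_ _ /imsetP[a aG ->] /imsetP[b bG ->]].
  by apply/imsetP; exists 1.
by apply/imsetP; exists (a * b); rewrite ?groupM.
Qed.
Canonical diagG_group := Group diagG_group_set.

Lemma diagG_sub : diagG G \subset GG.
Proof. by apply/subsetP => _ /imsetP[a aG ->]; rewrite mem_GxG aG. Qed.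

Lemma k1_diagG : k1 (diagG G) = 1.
Proof.
apply/setP => g; rewrite !inE; apply/imsetP/eqP => [[a _ [-> <-]] // | ->].
by exists 1.
Qed.

Lemma mem_diagG (a b : gT) : ((a, b) \in diagG G) = (a \in G) && (a == b).
Proof.
apply/imsetP/andP => [[c cG [-> ->]] | [aG /eqP <-]]; first by split.
by exists a.
Qed.

Lemma mark_diagG (uT : finGroupType) (i f : {ffun uT -> gT}) :
    i \in homs G uT -> injective i -> f \in homs G uT ->
  mark G (diagG G) (graph f i)
    = (#|'C_G(im i)| * (graph f i \in graph i i :^: GG))%N.
Proof.
move=> iH i_inj fH.
have diagJ h v : h \in homs G uT -> v \in GG ->
    (graph h i :^ v \subset diagG G) = [forall u, h u ^ v.1 == i u ^ v.2].
  case: v => a b hH; rewrite mem_GxG => /andP[aG bG].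
  apply/subsetP/forallP => [sub u | E _ /imsetP[_ /imsetP[u _ ->] ->]].
    have: (h u, i u) ^ (a, b) \in diagG G by apply: sub; rewrite memJ_conjg imset_f.
    by rewrite mem_diagG => /andP[].
  by rewrite mem_diagG groupJ ?(homs_in _ hH) //; apply: E.
have [fi | fi] := boolP (_ \in _); last first.
  rewrite muln0; apply/eqP; apply: contraR fi => /(mark_neq0 diagG_sub)[[a b] vG].
  rewrite (diagJ f) // => /forallP E; move: vG; rewrite mem_GxG => /andP[aG bG].
  rewrite graph_ii_class // block_self //; apply/imsetP; exists (b * a^-1).
    by rewrite groupM ?groupV.
  by apply/ffunP => u; rewrite ffunE conjgM -(eqP (E u)) conjgK.
have -> : mark G (diagG G) (graph f i) = mark G (diagG G) (graph i i).
  by case/imsetP: fi => v vG ->; rewrite mark_conjr ?diagG_sub.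
rewrite muln1; apply/eqP; rewrite -(eqn_pmul2l (cardG_gt0 G)).
have cardD : #|diagG G| = #|G| by rewrite card_imset // => a b [].
rewrite -{1}cardD mark_card ?diagG_sub //= mulnC -cardsX.
rewrite -(card_in_imset (f := fun v : pT => (v.1 * v.2, v.2))
  (D := setX 'C_G(im i) G)); last first.
  by move=> [c b] [c' b'] _ _ [/= E Eb]; rewrite Eb in E *; rewrite (mulIg _ _ _ E).
apply/eqP/eq_card => -[a b]; rewrite in_sep; apply/andP/imsetP.
  case=> vG; rewrite diagJ // => /forallP E; move: vG; rewrite mem_GxG => /andP[aG bG].
  exists (a * b^-1, b); last by rewrite mulgKV.
  rewrite in_setX bG andbT in_setI groupM ?groupV //=.
  apply/centP => _ /imsetP[u _ ->]; apply/commute_sym/commgP/conjg_fixP.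
  by rewrite conjgM (eqP (E u)) conjgK.
case=> -[c b'] /setXP[/= /setIP[cG /centP cC] bG] [-> ->].
have vG : (c * b', b') \in GG by rewrite mem_GxG groupM.
split=> //; rewrite diagJ //; apply/forallP => u /=; rewrite conjgM; apply/eqP.
by congr (_ ^ _); apply/conjg_fixP/commgP/commute_sym/cC/imset_f.
Qed.
End Identity.

Section Main.
Variables (gT : finGroupType) (G : {group gT}) (R : idomainType).
Hypothesis char0 : [pchar {fraction R}]%R =i pred0.
Hypothesis nonunit : forall U : {group gT}, U \subset G ->
  forall p : nat, prime p -> p %| Out_order U -> ~~ ((p%:R : R)%R \is a GRing.unit).
Variable e : {ffun {set (gT * gT)} -> R}.
Hypotheses (eR : in_RBlf G e) (e_idem : bmul G e e = e).
Hypothesis e_central : forall x : {ffun {set (gT * gT)} -> R},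
  in_RBlf G x -> bmul G e x = bmul G x e.
Local Notation GG := (GxG G).
Local Open Scope ring_scope.

(* A left-free [K] is the graph of its two projections, the second injective. *)
Lemma ghost_alternative (K : {group gT * gT}) : K \subset GG -> k1 K = 1%g ->
  (ghost G e [set 1%g] = 0 /\ ghost G e K = 0) \/
  (ghost G e [set 1%g] = #|G|%:R /\ ghost G e K = ghost G (bone G R) K).
Proof.
move=> KG kK; pose uT := subg_of K.
pose f : {ffun uT -> gT} := [ffun u => (sgval u).1].
pose i : {ffun uT -> gT} := [ffun u => (sgval u).2].
have KGu (u : uT) : ((sgval u).1 \in G) && ((sgval u).2 \in G).
  by rewrite -mem_GxG -surjective_pairing (subsetP KG) ?subgP.
have fH : f \in homs G uT.
  by apply/homsP; split=> [u | u v]; rewrite !ffunE //; case/andP: (KGu u).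
have iH : i \in homs G uT.
  by apply/homsP; split=> [u | u v]; rewrite !ffunE //; case/andP: (KGu u).
have KE : graph f i = K.
  apply/setP => v; apply/imsetP/idP => [[u _ ->] | vK].
    by rewrite !ffunE -surjective_pairing subgP.
  by exists (subg K v); rewrite // !ffunE subgK // -surjective_pairing.
have i_inj : injective i.
  move=> u v; rewrite !ffunE => E; apply: val_inj => /=; apply/eqP.
  rewrite eq_mulgV1; have: (sgval u * (sgval v)^-1)%g \in K.
    by rewrite groupM ?groupV ?subgP.
  have -> : (sgval u * (sgval v)^-1)%g = ((sgval u).1 * (sgval v).1^-1, 1)%g :> gT * gT.
    by congr (_, _); rewrite /= E mulgV.
  move=> inK; have: ((sgval u).1 * (sgval v).1^-1)%g \in k1 K by rewrite inE.
  by rewrite kK inE => /eqP ->.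
have triv1 : graph (triv gT uT) (triv gT uT) = [set 1%g].
  apply/setP => v; rewrite inE; apply/imsetP/eqP => [[u _ ->] | ->].
    by rewrite !ffunE.
  by exists 1%g; rewrite // !ffunE.
have nonunitN p : prime p -> (p %| relative_Out_order iH)%N ->
    p%:R \isn't a @GRing.unit R.
  move=> p_prime pN; apply: (nonunit (im_sub iH) p_prime).
  exact: dvdn_trans pN (dvdn_relative_Out_order iH).
have := block_alternative iH i_inj char0 eR e_idem e_central
  (card_block iH i_inj) nonunitN.
rewrite triv1 => -[[t nf] | [t nf]]; have := nf f fH; rewrite KE => ->; [by left | right].
split=> //; rewrite (ghost_transitive (K := diagG_group G) R K (diagG_sub G)) /=.
by rewrite -{2}KE mark_diagG // KE.
Qed.

Lemma central_idempotent_trivial : e = bzero gT R \/ e = bone G R.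
Proof.
have [t0 | tN0] := eqVneq (ghost G e [set 1%g]) 0; [left | right].
  apply: (ghost_inj char0 eR) => K KG kK.
  case: (ghost_alternative KG kK) => -[t1 //].
  by move/eqP: t1; rewrite t0 eq_sym char0_natr_eq0 // eqn0Ngt cardG_gt0.
have oneR : in_RBlf G (bone G R).
  exact: (@in_RBlf_transitive _ _ R (diagG_group G) (diagG_sub G) (k1_diagG G)).
have subE L : (e - bone G R) L = e L - bone G R L by rewrite 2!ffunE.
have dE A : ghost G (e - bone G R) A = ghost G e A - ghost G (bone G R) A.
  rewrite -sumrB; apply: eq_bigr => L _.
  by rewrite subE mulrnBl.
apply: subr0_eq; apply: (ghost_inj (G := G) char0) => [L NL | K KG kK].
  by rewrite subE eR // (oneR L NL) subrr.
case: (ghost_alternative KG kK) => -[t1]; first by rewrite t1 eqxx in tN0.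
by move=> E; rewrite dE E subrr.
Qed.
End Main.

Lemma int_fraction_char0 : [pchar {fraction int}]%R =i pred0.
Proof.
apply/pcharf0P => n; rewrite -(rmorph_nat (@FracField.tofrac int)) tofrac_eq0.
by rewrite Num.Theory.pnatr_eq0.
Qed.

Lemma prime_nonunit_int (p : nat) : prime p -> (p%:R : int)%R \isn't a GRing.unit.
Proof.
move=> p_prime; apply/negP => /unitrPr[y] /(congr1 absz).
rewrite mulr_natl -mulr_natl abszM /= => /eqP.
by rewrite muln_eq1 natz /= => /andP[/eqP p1 _]; rewrite p1 in p_prime.
Qed.

Theorem theorem5p11 (gT : finGroupType) (G : {group gT}) :
  (forall R : idomainType,
     [pchar {fraction R}]%R =i pred0 ->
     (forall U : {group gT}, U \subset G ->
        forall p : nat, prime p -> p %| Out_order U ->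
        ~~ ((p%:R : R)%R \is a GRing.unit)) ->
     forall e : {ffun {set (gT * gT)} -> R},
       in_RBlf G e ->
       bmul G e e = e ->
       (forall x : {ffun {set (gT * gT)} -> R},
          in_RBlf G x -> bmul G e x = bmul G x e) ->
       e = bzero gT R \/ e = bone G R)
  /\
  (forall e : {ffun {set (gT * gT)} -> int},
     in_RBlf G e ->
     bmul G e e = e ->
     (forall x : {ffun {set (gT * gT)} -> int},
        in_RBlf G x -> bmul G e x = bmul G x e) ->
     e = bzero gT int \/ e = bone G int).
Proof.
split=> [R char0 nonunit e | e]; first exact: central_idempotent_trivial.
apply: central_idempotent_trivial => [|U _ p p_prime _].
  exact: int_fraction_char0.
exact: prime_nonunit_int.
Qed.
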